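(* Let $L\in\mathcal{B}(M_k)$, let $\mu$ be a measure on $M_k$ with $\#\operatorname{supp}\mu>1$, and let $\varepsilon>0$. Then there exists $M_\delta\in\mathcal{B}(M_k)$ such that $\|L-M_\delta\|<\varepsilon$ and $M_\delta$ is $\phi$-Erg for $\mu$ and irreducible for $\mu$.
   Context: $M_k$ is the set of complex $k\times k$ matrices with Borel $\sigma$-algebra and Hilbert-Schmidt norm $\|A\|=\sqrt{\operatorname{tr}(AA^\dagger)}$. $\mathcal{B}(M_k)$ is the space of continuous bounded maps $L:M_k\to M_k$ with norm $\|L\|=\sup_{v\in M_k}\|L(v)\|$. $\mu$ is a Borel measure on $M_k$ and $\operatorname{supp}\mu$ its support. A subspace $E\subset\mathbb{C}^k$ is $(L,\mu)$-invariant if $L(v)E\subset E$ for all $v\in\operatorname{supp}\mu$. $L$ is $\phi$-Erg for $\mu$ if there exists a unique minimal non-trivial (i.e. $\neq\{0\}$; $E=\mathbb{C}^k$ is allowed) subspace $E$ that is $(L,\mu)$-invariant. $L$ is irreducible for $\mu$ if the only $(L,\mu)$-invariant subspaces are $\{0\}$ and $\mathbb{C}^k$. *)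

(* Defs.v *)
From HB Require Import structures.
From mathcomp Require Import all_boot all_order all_algebra.
From mathcomp Require Import all_classical all_reals all_analysis.
From mathcomp Require Import complex.

Set Implicit Arguments.
Unset Strict Implicit.
Unset Printing Implicit Defensive.

Import Order.TTheory GRing.Theory Num.Theory.
Import numFieldNormedType.Exports.

Local Open Scope classical_set_scope.
Local Open Scope ring_scope.
Local Open Scope sesquilinear_scope.

(* R[i] itself carries no topology in the libraries; declaring it as a
   numClosedFieldType gives it (hence matrices over it) the topology induced
   by the complex modulus. *)
Definition Cplx (R : realType) : numClosedFieldType := R[i]%C.

Notation Mk R k := 'M[Cplx R]_k.
Notation Ck R k := 'cV[Cplx R]_k.

Definition MkBorel (R : realType) (k : nat) : measurableType _ :=
  g_sigma_algebraType (@open (Mk R k)).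

(* tr (A A^dagger) is a sum of squared moduli, hence a nonnegative real:
   taking its real part only changes its type from Cplx R to R. *)
Definition hsnorm (R : realType) (k : nat) (A : Mk R k) : R :=
  Num.sqrt (complex.Re (\tr (A *m A ^t*))).

(* The topology of Mk R k is that of entrywise convergence, which is the one
   induced by hsnorm. *)
Definition boundedC (R : realType) (k : nat) : set (Mk R k -> Mk R k) :=
  [set L | continuous L /\ exists B : R, forall v, hsnorm (L v) <= B].

Definition supnorm (R : realType) (k : nat) (L : Mk R k -> Mk R k) : R :=
  sup (range (fun v => hsnorm (L v))).

Definition msupp (R : realType) (k : nat)
    (mu : {measure set (MkBorel R k) -> \bar R}) : set (Mk R k) :=
  [set v | forall U : set (Mk R k), open U -> U v -> (0 < mu U)%E].

Definition invariant_subspace (R : realType) (k : nat) (L : Mk R k -> Mk R k)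
    (mu : {measure set (MkBorel R k) -> \bar R}) (E : {vspace Ck R k}) : Prop :=
  forall v, msupp mu v -> forall x, x \in E -> L v *m x \in E.

Definition minimal_invariant (R : realType) (k : nat) (L : Mk R k -> Mk R k)
    (mu : {measure set (MkBorel R k) -> \bar R}) (E : {vspace Ck R k}) : Prop :=
  [/\ E <> 0%VS, invariant_subspace L mu E &
      forall F : {vspace Ck R k}, F <> 0%VS -> invariant_subspace L mu F ->
        (F <= E)%VS -> F = E].

Definition phi_Erg (R : realType) (k : nat) (L : Mk R k -> Mk R k)
    (mu : {measure set (MkBorel R k) -> \bar R}) : Prop :=
  exists! E : {vspace Ck R k}, minimal_invariant L mu E.

Definition irreducible_for (R : realType) (k : nat) (L : Mk R k -> Mk R k)
    (mu : {measure set (MkBorel R k) -> \bar R}) : Prop :=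
  forall E : {vspace Ck R k}, invariant_subspace L mu E ->
    E = 0%VS \/ E = fullv.

(* Main.v *)
(* If the [k ^ 2] matrices [X ^+ i *m Y *m X ^+ j], [i, j < k], are linearly
   independent, then [X] and [Y] have no common proper nonzero invariant
   subspace.  Along the line from a given pair [(A, B)] to the pair
   [(diag (0, ..., k - 1), all-ones matrix)], independence is the nonvanishing
   of a polynomial in the parameter.  At the endpoint it holds by a Vandermonde
   determinant, so it holds for arbitrarily small parameters.  Applied to
   [A = L v0] and [B = L v1] for two points [v0 <> v1] of the support, a
   continuous function equal to [0] at [v0] and to [1] at [v1] interpolates
   between the two small corrections. *)
From HB Require Import structures.
Require Import Defs.
From mathcomp Require Import all_boot all_order all_algebra.
From mathcomp Require Import all_classical all_reals all_analysis.
From mathcomp Require Import complex.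
Set Implicit Arguments.
Unset Strict Implicit.
Unset Printing Implicit Defensive.
Import Order.TTheory GRing.Theory Num.Theory.
Import numFieldNormedType.Exports.
Local Open Scope classical_set_scope.
Local Open Scope ring_scope.
Local Open Scope sesquilinear_scope.

(** Linear independence of the products [X ^+ i *m Y *m X ^+ j] is expressed as invertibility of the
    linear map sending a coefficient matrix [C] to their combination, hence as a nonzero
    determinant. The ring [T] is general so that the entries may be polynomials. *)
Definition sandwich (T : comNzRingType) n (X Y C : 'M[T]_n) : 'M[T]_n :=
  \sum_(i < n) \sum_(j < n) C i j *: (X ^+ i *m Y *m X ^+ j).

Lemma sandwich_is_linear (T : comNzRingType) n (X Y : 'M[T]_n) :
  linear (sandwich X Y).
Proof.
move=> a C D; rewrite /sandwich scaler_sumr -big_split /=.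
apply: eq_bigr => i _; rewrite scaler_sumr -big_split /=.
by apply: eq_bigr => j _; rewrite !mxE scalerDl scalerA.
Qed.

HB.instance Definition _ (T : comNzRingType) n (X Y : 'M[T]_n) :=
  GRing.isLinear.Build T 'M[T]_n 'M[T]_n _ (sandwich X Y)
    (sandwich_is_linear X Y).

Lemma map_sandwich (T U : comNzRingType) (f : {rmorphism T -> U}) n
    (X Y C : 'M[T]_n) :
  map_mx f (sandwich X Y C) = sandwich (map_mx f X) (map_mx f Y) (map_mx f C).
Proof.
rewrite /sandwich map_mx_sum; apply: eq_bigr => i _.
rewrite map_mx_sum; apply: eq_bigr => j _.
by rewrite map_mxZ !map_mxM !rmorphXn !mxE.
Qed.

Lemma map_lin_sandwich (T U : comNzRingType) (f : {rmorphism T -> U}) n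
    (X Y : 'M[T]_n) :
  map_mx f (lin_mx (sandwich X Y)) =
  lin_mx (sandwich (map_mx f X) (map_mx f Y)).
Proof.
apply: map_lin_mx => C; exact: map_sandwich.
Qed.

Lemma sandwich_mulmx_closed (F : fieldType) n (X Y C : 'M[F]_n)
    (E : {vspace 'cV[F]_n}) :
    (forall x, x \in E -> X *m x \in E) -> (forall x, x \in E -> Y *m x \in E) ->
  forall x, x \in E -> sandwich X Y C *m x \in E.
Proof.
move=> EX EY.
have EXn m x : x \in E -> X ^+ m *m x \in E.
  elim: m => [|m IH] xE; first by rewrite expr0 mul1mx.
  by rewrite exprS -mulmxA; apply/EX/IH.
move=> x xE; rewrite mulmx_suml memv_suml // => i _.
rewrite mulmx_suml memv_suml // => j _.
by rewrite -scalemxAl memvZ // -!mulmxA; apply/EXn/EY/EXn.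
Qed.

(** Invertibility makes every matrix a sandwich, so [E] is stable under all matrices, and these
    carry a nonzero vector anywhere. *)
Lemma lin_sandwich_unit_irreducible (F : fieldType) n (X Y : 'M[F]_n)
    (E : {vspace 'cV[F]_n}) :
    lin_mx (sandwich X Y) \in unitmx ->
    (forall x, x \in E -> X *m x \in E) -> (forall x, x \in E -> Y *m x \in E) ->
  E = 0%VS \/ E = fullv.
Proof.
move=> XYunit EX EY; have [->|E0] := eqVneq E 0%VS; [by left | right].
have xE := memv_pick E; have := E0; rewrite -vpick0; set x := vpick E in xE *.
case/matrix0Pn=> a [b xa0]; rewrite ord1 in xa0.
apply/eqP; rewrite eqEsubv subvf; apply/subvP => y _.
(* A matrix of rank at most one: it reads off coordinate [a] of a vector, rescaled to be 1 on [x],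
   and multiplies [y] by it. *)
pose Z := (x a 0)^-1 *: (y *m delta_mx 0 a).
have -> : y = Z *m x.
  rewrite /Z -scalemxAl -mulmxA -rowE; apply/matrixP => i j.
  by rewrite !mxE big_ord1 !mxE ord1 mulrCA mulVf ?mulr1.
suff -> : Z = sandwich X Y (vec_mx (mxvec Z *m invmx (lin_mx (sandwich X Y)))).
  exact: sandwich_mulmx_closed.
by apply: (can_inj mxvecK); rewrite -[RHS]mul_vec_lin vec_mxK mulmxKV.
Qed.

(* The entries of the sandwich are those of [V^T C V], with [V] Vandermonde. *)
Lemma lin_sandwich_diag_const1_unit (F : numFieldType) n :
  lin_mx (sandwich (diag_mx (\row_(i < n) i%:R)) (const_mx 1 : 'M[F]_n))
    \in unitmx.
Proof.
set d := \row_i _; pose V := Vandermonde n d : 'M[F]_n.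
(* The nodes [0, ..., n - 1] are distinct because the characteristic is zero. *)
have Vu : V \in unitmx.
  rewrite unitmxE unitfE det_Vandermonde; apply/prodf_neq0 => i _.
  apply/prodf_neq0 => j ij; rewrite !mxE subr_eq0 eqr_nat.
  by rewrite neq_ltn ij orbT.
have dX i : diag_mx d ^+ i = diag_mx (map_mx (fun x => x ^+ i) d).
  elim: i => [|i IH]; last first.
    rewrite exprS IH [LHS]mulmx_diag; congr diag_mx.
    by apply/rowP => j; rewrite !mxE exprS.
  rewrite expr0; apply/matrixP => a b.
  by rewrite !mxE expr0.
have sE C : sandwich (diag_mx d) (const_mx 1) C = V^T *m C *m V.
  apply/matrixP => a b; rewrite summxE mxE.
  under [RHS]eq_bigr => j _ do rewrite mxE mulr_suml.
  rewrite exchange_big /=; apply: eq_bigr => i _.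
  rewrite summxE; apply: eq_bigr => j _.
  rewrite !dX mul_diag_mx mul_mx_diag !mxE mulr1.
  by rewrite mulrA [C i j * _]mulrC.
rewrite -row_free_unit; apply: inj_row_free => v.
rewrite -[v](@vec_mxK _ n n) mul_vec_lin /= sE => /(canRL mxvecK); rewrite linear0.
move/(congr1 (fun A => A *m invmx V)); rewrite mulmxK // mul0mx.
move/(congr1 (fun A => invmx V^T *m A)).
by rewrite mulKmx ?unitmx_tr // mulmx0 => ->; rewrite linear0.
Qed.

(** The directions come before the sequence [f], so the scale of [f] may later depend on their
    norms. *)
Lemma lin_sandwich_unit_line (F : numFieldType) n (A B : 'M[F]_n) :
  exists D E : 'M[F]_n, forall f : nat -> F, injective f ->
  exists m : nat, lin_mx (sandwich (A + f m *: D) (B + f m *: E)) \in unitmx.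
Proof.
set P : 'M[F]_n := diag_mx (\row_(i < n) i%:R); set Q : 'M[F]_n := const_mx 1.
exists (P - A), (Q - B) => f finj.
pose line (G H : 'M[F]_n) : 'M[{poly F}]_n :=
  map_mx polyC G + 'X *: map_mx polyC (H - G).
have lineE t G H : map_mx (horner_eval t) (line G H) = G + t *: (H - G).
  by apply/matrixP => i j; rewrite !mxE /horner_eval !hornerE.
pose p := \det (lin_mx (sandwich (line A P) (line B Q))).
have pE t :
    p.[t] = \det (lin_mx (sandwich (A + t *: (P - A)) (B + t *: (Q - B)))).
  by rewrite -horner_evalE -det_map_mx map_lin_sandwich !lineE.
(* The parameter 1 gives the endpoint [(P, Q)]. *)
have p0 : p != 0.
  apply: contraTneq (lin_sandwich_diag_const1_unit F n) => p0.
  by have := pE 1; rewrite p0 horner0 !scale1r !subrKC unitmxE => <-; rewrite unitr0.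
(* Otherwise the first [size p] values of [f] would be distinct roots of [p], more than its degree
   allows. *)
apply: contrapT => nounit.
suff /(max_poly_roots p0): all (root p) (mkseq f (size p)).
  by rewrite mkseq_uniq // size_mkseq ltnn => /(_ isT).
apply/allP => _ /mapP [m _ ->]; apply: contrapT => /negP fm.
by apply: nounit; exists m; rewrite unitmxE -pE unitfE.
Qed.

Lemma hsnorm_sqr (R : realType) k (A : Mk R k) :
  ((hsnorm A)%:C%C : Cplx R) ^+ 2 = \sum_i \sum_j `|A i j| ^+ 2.
Proof.
have trE : \tr (A *m A ^t*) = \sum_i \sum_j `|A i j| ^+ 2.
  by apply: eq_bigr => i _; rewrite mxE; apply: eq_bigr => j _; rewrite !mxE normCK.
have tr0 : 0 <= \tr (A *m A ^t*).
  by rewrite trE; do 2!apply: sumr_ge0 => ? _; rewrite exprn_ge0.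
rewrite -trE /hsnorm; have := tr0; case: (\tr _) => a b.
rewrite (@lecE R) /= => /andP[/eqP -> a0].
by rewrite -rmorphXn /= sqr_sqrtr.
Qed.

Lemma hsnorm_ge0 (R : realType) k (A : Mk R k) : 0 <= hsnorm A.
Proof. exact: sqrtr_ge0. Qed.

Lemma hsnormC_ge0 (R : realType) k (A : Mk R k) : 0 <= ((hsnorm A)%:C%C : Cplx R).
Proof. by rewrite (@lecR R 0) hsnorm_ge0. Qed.

Lemma entry_le_mx_norm (K : numFieldType) m n (A : 'M[K]_(m, n)) i j :
  `|A i j| <= `|A|.
Proof.
rewrite [leRHS]/Num.norm /= mx_normE -[leLHS]nngE num_le.
exact: (le_bigmax _ _ (i, j)).
Qed.

(** Each of the [k ^ 2] squared entries is at most the square of the largest modulus; the square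
    root leaves the factor [k]. Triangle inequalities below are taken in the max norm and
    transferred to [hsnorm] at this cost. *)
Lemma hsnorm_le_mx_norm (R : realType) k (A : Mk R k) :
  ((hsnorm A)%:C%C : Cplx R) <= `|A| *+ k.
Proof.
rewrite -(@ler_pXn2r _ 2) ?nnegrE ?hsnormC_ge0 ?mulrn_wge0 //.
rewrite hsnorm_sqr expr2 mulrnAl mulrnAr.
have sum_le (F : 'I_k -> Cplx R) M : (forall i, F i <= M) -> \sum_i F i <= M *+ k.
  by move=> FM; rewrite -[k in leRHS]card_ord -sumr_const ler_sum.
apply: (sum_le) => i; apply: sum_le => j.
by rewrite -expr2 ler_pXn2r ?nnegrE // entry_le_mx_norm.
Qed.

Lemma mx_norm_le_hsnorm (R : realType) k (A : Mk R k) :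
  `|A| <= ((hsnorm A)%:C%C : Cplx R).
Proof.
rewrite [leLHS]/Num.norm /=; have [->|/mx_norm_neq0 [[i j] ->]] := eqVneq (mx_norm A) 0.
  exact: hsnormC_ge0.
rewrite -(@ler_pXn2r _ 2) ?nnegrE ?hsnormC_ge0 ?normr_ge0 // hsnorm_sqr.
rewrite (bigD1 i) //= (bigD1 j) //= -addrA ler_wpDr // addr_ge0 //.
  by apply: sumr_ge0 => ? _; rewrite exprn_ge0.
by do 2!apply: sumr_ge0 => ? _; rewrite exprn_ge0.
Qed.

Lemma continuous_separation (K : numFieldType) m n (u v : 'M[K]_(m, n)) : u <> v ->
  exists g : 'M[K]_(m, n) -> K,
    [/\ continuous g, g u = 0, g v = 1 & forall w, `|g w| <= 2].
Proof.
move=> uv; have [i [j uvij]] : exists i j, u i j <> v i j.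
  apply: contrapT => H; apply: uv; apply/matrixP => i j.
  by apply: contrapT => ?; apply: H; exists i, j.
pose z (w : 'M[K]_(m, n)) := `|(w i j - u i j) / (v i j - u i j)|.
have z0 w : 0 <= z w by exact: normr_ge0.
have z1 w : 0 < 1 + z w by rewrite ltr_pwDl.
(* Since [z] is 0 at [u] and 1 at [v], the quotient [z / (1 + z)], which stays below 1, takes the
   values 0 and 1/2; the factor 2 normalises the latter. *)
exists (fun w => 2 * (z w / (1 + z w))); split.
- move=> w.
  have cz : z x @[x --> w] --> z w.
    apply: (@cvg_norm _ _ _ (nbhs w)).
    apply: (@cvgM _ _ (nbhs w)); last exact: cvg_cst.
    by apply: (@cvgB _ _ _ (nbhs w)); [exact: coord_continuous | exact: cvg_cst].
  apply: (@cvgM _ _ (nbhs w)); first exact: cvg_cst.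
  apply: (@cvgM _ _ (nbhs w)) => //.
  apply: (@cvgV _ _ (nbhs w)); first exact: lt0r_neq0.
  by apply: (@cvgD _ _ _ (nbhs w)) => //; exact: cvg_cst.
- by rewrite /z subrr mul0r normr0 mul0r mulr0.
- rewrite /z divff; last by rewrite subr_eq0 eq_sym; apply/eqP.
  by rewrite normr1 mul1r [LHS]divff // pnatr_eq0.
- move=> w; rewrite ger0_norm ?mulr_ge0 ?invr_ge0 ?(ltW (z1 w)) // ler_piMr //.
  by rewrite ler_pdivrMr // mul1r lerDr.
Qed.

Lemma exists_neq_of_not_card_le1 (T : Type) (A : set T) : ~~ (A #<= `I_1)%card ->
  exists u v, [/\ A u, A v & u <> v].
Proof.
move=> A1; apply: contrapT => H; move/negP: A1; apply.
have [->|/set0P [x Ax]] := eqVneq A set0; first exact: card_ge0.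
rewrite -(card_le_eqr (@card_set1 _ x)); apply: subset_card_le => y Ay.
by apply: contrapT => yx; apply: H; exists y, x.
Qed.

(** In positive dimension [fullv] is nonzero, and irreducibility leaves no other candidate. *)
Lemma irreducible_phi_Erg (R : realType) k (L : Mk R k.+1 -> Mk R k.+1)
    (mu : {measure set (MkBorel R k.+1) -> \bar R}) :
  irreducible_for L mu -> phi_Erg L mu.
Proof.
move=> irr; exists fullv; split.
  split => [|v _ x _|F F0 /irr[]//]; last exact: memvf.
  by apply/eqP; rewrite -dimv_eq0 dimvf.
by move=> E [E0 /irr[]].
Qed.

Theorem theorem7p5 (R : realType) (k : nat) (L : Mk R k -> Mk R k)
    (mu : {measure set (MkBorel R k) -> \bar R}) (eps : R) :
  boundedC L ->
  ~~ (msupp mu #<= `I_1)%card ->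
  0 < eps ->
  exists M : Mk R k -> Mk R k,
    [/\ boundedC M, supnorm (L \- M) < eps, phi_Erg M mu &
        irreducible_for M mu].
Proof.
move=> [cL [B LB]] /exists_neq_of_not_card_le1[v0 [v1 [suppv0 suppv1 v01]]] eps0.
(* In dimension 0 there is only one matrix, so the support cannot have two points. *)
case: k => [|k] in L mu cL LB v0 v1 suppv0 suppv1 v01 *.
  by case: v01; rewrite [v0]flatmx0 [v1]flatmx0.
have [g [cg g0 g1 g2]] := continuous_separation v01.
have [D [E DE]] := lin_sandwich_unit_line (L v0) (L v1).
(* The correction is [D] at [v0] and [E] at [v1]; [K] bounds it uniformly, with the 2 coming from
   the bound on [g] and [k.+1] from the norm comparison. *)
pose pert v := D + g v *: (E - D).
pose K := (hsnorm D + 2 * hsnorm (E - D)) *+ k.+1.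
have K0 : 0 <= K by rewrite mulrn_wge0 // addr_ge0 ?mulr_ge0 ?hsnorm_ge0.
have le_pert (c : Cplx R) t v : `|c| <= t%:C%C -> hsnorm (c *: pert v) <= t * K.
  move=> ct; rewrite -(@lecR R) (le_trans (hsnorm_le_mx_norm _)) //.
  rewrite /K mulrnAr rmorphMn /= lerMn2r /= normrZ rmorphM /=.
  rewrite ler_pM // rmorphD rmorphM /=.
  rewrite (le_trans (ler_normD _ _)) // lerD ?mx_norm_le_hsnorm // normrZ.
  by rewrite ler_pM ?mx_norm_le_hsnorm // rmorph_nat.
(* Dividing by [K + 1] gives [e * K < eps] even when [K] is 0, so a non-strict bound on the supremum
   suffices. *)
pose e := eps / (K + 1).
have K1 : 0 < K + 1 by rewrite ltr_wpDl.
have e0 : 0 < e by rewrite divr_gt0.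
pose f m : Cplx R := (e / m.+1%:R)%:C%C.
have f_inj : injective f.
  move=> m n [] /(mulfI (lt0r_neq0 e0)) /invr_inj /eqP.
  by rewrite eqr_nat => /eqP [].
have [m unitm] := DE f f_inj.
have t0 : 0 <= e / m.+1%:R by rewrite divr_ge0 // ltW.
have fe : `|f m| <= e%:C%C.
  rewrite ger0_norm ?(@lecR R 0) // (@lecR R).
  by rewrite ler_pdivrMr // ler_peMr ?ler1n // ltW.
pose M v := L v + f m *: pert v.
have Mirr : irreducible_for M mu.
  move=> F FM; apply: (lin_sandwich_unit_irreducible unitm) => x xF.
    by have := FM _ suppv0 _ xF; rewrite /M /pert g0 scale0r addr0.
  by have := FM _ suppv1 _ xF; rewrite /M /pert g1 scale1r subrKC.
exists M; split; [| | exact: irreducible_phi_Erg | exact: Mirr].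
- split.
    move=> v; apply: (@cvgD _ _ _ (nbhs v)); first exact: cL.
    apply: (@cvgZ _ _ _ (nbhs v)); first exact: cvg_cst.
    apply: (@cvgD _ _ _ (nbhs v)); first exact: cvg_cst.
    by apply: (@cvgZ _ _ _ (nbhs v)); [exact: cg | exact: cvg_cst].
  exists ((B + e * K) *+ k.+1) => v.
  rewrite -(@lecR R) (le_trans (hsnorm_le_mx_norm _)) // rmorphMn lerMn2r /=.
  rewrite (le_trans (ler_normD _ _)) // rmorphD lerD //.
    by rewrite (le_trans (mx_norm_le_hsnorm _)) // (@lecR R).
  by rewrite (le_trans (mx_norm_le_hsnorm _)) // (@lecR R) le_pert.
- apply: (@le_lt_trans _ _ (e * K)); last first.
    by rewrite -[ltRHS](divfK (lt0r_neq0 K1)) ltr_pM2l // ltrDl.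
  apply: ge_sup; first by exists (hsnorm ((L \- M) 0)), 0.
  move=> _ [v _ <-]; rewrite (_ : (L \- M) v = - f m *: pert v).
    by rewrite le_pert // normrN.
  by rewrite /M /= opprD addNKr scaleNr.
Qed.
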